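(* Let $t$ be a selfadjoint regular Fredholm operator on a Hilbert $C^*$-module $E$ and let $\varepsilon>0$ be such that $D+t$ is a selfadjoint regular Fredholm operator for every selfadjoint bounded adjointable operator $D$ on $E$ satisfying $\|D\|\le\varepsilon$. Suppose that $\lambda\mapsto A_\lambda$ is a continuous path (parametrized by a real interval) of selfadjoint bounded adjointable operators on $E$ with respect to the norm topology, with $\|A_\lambda\|\le\varepsilon$ for each $\lambda$. Then $\lambda\mapsto t+A_\lambda$ is a continuous path of selfadjoint regular Fredholm operators with respect to the gap metric.
   Context: For a Hilbert $C^*$-module $E$, $L(E)$ denotes the bounded adjointable operators on $E$ and $K(E)$ the compact operators on $E$ (the norm closure of the linear span of the operators $z\mapsto x\langle y,z\rangle$, $x,y\in E$). A closed densely defined operator $t:D(t)\subseteq E\to E$ with densely defined adjoint $t^*$ is called regular if $I+t^*t$ has dense range. A regular operator $t$ is selfadjoint if $t=t^*$. A regular operator $t$ is Fredholm if it has a pseudo left inverse and a pseudo right inverse. Here $G\in L(E)$ is a pseudo left inverse of $t$ if $Gt$ is closable, its closure $\overline{Gt}$ lies in $L(E)$, and $\overline{Gt}\equiv 1 \bmod K(E)$; and $G\in L(E)$ is a pseudo right inverse of $t$ if $tG$ is closable, $\overline{tG}\in L(E)$, and $\overline{tG}\equiv 1\bmod K(E)$. Gap metric: for a regular operator $t$ on $E$, the graph $G(t)=\{(x,t(x)):x\in D(t)\}$ is orthogonally complemented in $E\oplus E$; let $P_{G(t)}$ be the orthogonal projection onto it. For regular operators $t,s$ on $E$, the gap metric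 is $g(t,s)=\|P_{G(t)}-P_{G(s)}\|$. Sums $D+t$ and $t+A_\lambda$ with bounded operators have domain $D(t)$. An $\varepsilon>0$ with the stated property exists for every selfadjoint regular Fredholm $t$. *)

(* Defs.v *)
From HB Require Import structures.
From mathcomp Require Import all_boot all_order all_algebra.
From mathcomp Require Import complex.
From mathcomp Require Import all_classical all_reals all_analysis.

Set Implicit Arguments.
Unset Strict Implicit.
Unset Printing Implicit Defensive.

Import Order.TTheory GRing.Theory Num.Theory.
Import numFieldNormedType.Exports.

Local Open Scope classical_set_scope.
Local Open Scope ring_scope.

(* C*-algebras are complex and need not be unital, so that the product cannot
   come from the (unital) ring structures of the library. *)
HB.mixin Record NormedModule_isCstarAlgebra (R : realType) A
    of CompleteNormedModule R[i] A := {
  cmul : A -> A -> A ;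
  cstar : A -> A ;
  cmulA : forall a b c, cmul a (cmul b c) = cmul (cmul a b) c ;
  cmulDl : forall a b c, cmul (a + b) c = cmul a c + cmul b c ;
  cmulDr : forall a b c, cmul a (b + c) = cmul a b + cmul a c ;
  cmulZl : forall (k : R[i]) a b, cmul (k *: a) b = k *: cmul a b ;
  cmulZr : forall (k : R[i]) a b, cmul a (k *: b) = k *: cmul a b ;
  cstarK : forall a, cstar (cstar a) = a ;
  cstarD : forall a b, cstar (a + b) = cstar a + cstar b ;
  cstarZ : forall (k : R[i]) a, cstar (k *: a) = conjc k *: cstar a ;
  cstarM : forall a b, cstar (cmul a b) = cmul (cstar b) (cstar a) ;
  cnormM : forall a b, `|cmul a b| <= `|a| * `|b| ;
  cnorm_star : forall a, `|cmul (cstar a) a| = `|a| ^+ 2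
}.

#[short(type="cstarAlgebraType")]
HB.structure Definition CstarAlgebra (R : realType) :=
  {A of CompleteNormedModule R[i] A & NormedModule_isCstarAlgebra R A}.

Definition cpositive (R : realType) (A : cstarAlgebraType R) (a : A) : Prop :=
  exists b : A, a = cmul (cstar b) b.

(* Right Hilbert modules, with an inner product that is linear in its second
   argument; [hnorm_ip] says that the norm of the underlying Banach space is
   the one induced by the inner product. *)
HB.mixin Record NormedModule_isHilbertModule (R : realType)
    (A : cstarAlgebraType R) E of CompleteNormedModule R[i] E := {
  hact : E -> A -> E ;
  hactDl : forall x y a, hact (x + y) a = hact x a + hact y a ;
  hactDr : forall x a b, hact x (a + b) = hact x a + hact x b ;
  hactM : forall x a b, hact x (cmul a b) = hact (hact x a) b ;
  hactZl : forall (k : R[i]) x a, hact (k *: x) a = k *: hact x a ;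
  hactZr : forall (k : R[i]) x a, hact x (k *: a) = k *: hact x a ;
  hip : E -> E -> A ;
  hipDr : forall x y z, hip x (y + z) = hip x y + hip x z ;
  hipZr : forall (k : R[i]) x y, hip x (k *: y) = k *: hip x y ;
  hip_act : forall x y a, hip x (hact y a) = cmul (hip x y) a ;
  hip_star : forall x y, hip x y = cstar (hip y x) ;
  hip_ge0 : forall x, cpositive (hip x x) ;
  hip_eq0 : forall x, hip x x = 0 -> x = 0 ;
  hnorm_ip : forall x, `|x| ^+ 2 = `|hip x x|
}.

#[short(type="hilbertModuleType")]
HB.structure Definition HilbertModule (R : realType)
    (A : cstarAlgebraType R) :=
  {E of CompleteNormedModule R[i] E & NormedModule_isHilbertModule R A E}.

(* The norm and the operator norm determined by an [A]-valued inner product.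
   They are used for [E] and for the direct sum of two copies of [E], whose
   Hilbert module norm is not the sup norm that the library puts on the
   product type [E * E]. *)
Section InnerProductNorm.
Variables (R : realType) (A : cstarAlgebraType R) (F : Type) (ip : F -> F -> A).

Definition ipnorm (x : F) : R := Num.sqrt (complex.Re `|ip x x|).

Definition ipopnorm (T : F -> F) : R :=
  sup [set ipnorm (T x) | x in [set x | ipnorm x <= 1]].

End InnerProductNorm.

Section Operators.
Variables (R : realType) (A : cstarAlgebraType R) (E : hilbertModuleType A).
Implicit Types (T S D G : E -> E).

Definition opnorm T : R := ipopnorm (@hip R A E) T.

Definition opdist T S : R := opnorm (fun x => T x - S x).

(* Adjointability implies linearity over the complex numbers and over [A]. *)
Definition bounded_adjointable T : Prop :=
  (exists M : R, forall x, ipnorm (@hip R A E) (T x)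
                           <= M * ipnorm (@hip R A E) x) /\
  (exists S, forall x y, hip (T x) y = hip x (S y)).

Definition bounded_selfadjoint T : Prop :=
  bounded_adjointable T /\ forall x y, hip (T x) y = hip x (T y).

Definition rank_one (x y : E) : E -> E := fun z => hact x (hip y z).

Definition finite_rank (s : seq (R[i] * E * E)) : E -> E :=
  fun z => \sum_(p <- s) p.1.1 *: rank_one p.1.2 p.2 z.

Definition compact_op T : Prop :=
  bounded_adjointable T /\
  forall e : R, 0 < e -> exists s, opdist T (finite_rank s) < e.

(* A partially defined map; the values of [pval] outside [pdom] are
   irrelevant, and everything below depends on the graph only. *)
Record partial_op := PartialOp { pdom : set E ; pval : E -> E }.

Implicit Types t s : partial_op.

Definition pgraph t : set (E * E) :=
  [set z | pdom t z.1 /\ z.2 = pval t z.1].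

Definition ptotal T : partial_op := PartialOp setT T.

Definition padd t s : partial_op :=
  PartialOp (pdom t `&` pdom s) (fun x => pval t x + pval s x).

Definition pcomp t s : partial_op :=
  PartialOp [set x | pdom s x /\ pdom t (pval s x)]
            (fun x => pval t (pval s x)).

Definition linear_op t : Prop :=
  [/\ pdom t 0,
      forall x y, pdom t x -> pdom t y ->
        pdom t (x + y) /\ pval t (x + y) = pval t x + pval t y,
      forall (k : R[i]) x, pdom t x ->
        pdom t (k *: x) /\ pval t (k *: x) = k *: pval t x &
      forall x (a : A), pdom t x ->
        pdom t (hact x a) /\ pval t (hact x a) = hact (pval t x) a].

(* Only meaningful for densely defined [t], where the witness is unique. *)
Definition padjoint t : partial_op :=
  let W y := [set z : E | forall x, pdom t x -> hip (pval t x) y = hip x z] in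
  PartialOp [set y | W y !=set0] (fun y => xget 0 (W y)).

(* The norm of the direct sum induces the product topology on [E * E], so that
   [closed] and [closure] of graphs have their usual meaning. *)
Definition regular_op t : Prop :=
  [/\ linear_op t, closed (pgraph t), dense (pdom t),
      dense (pdom (padjoint t)) &
      let u := padd (ptotal id) (pcomp (padjoint t) t) in
      dense [set pval u x | x in pdom u]].

Definition selfadjoint_op t : Prop := pgraph t = pgraph (padjoint t).

Definition closable t : Prop :=
  forall x y y', closure (pgraph t) (x, y) -> closure (pgraph t) (x, y') ->
    y = y'.

Definition closable_to_one_mod_compact t : Prop :=
  closable t /\
  exists T, [/\ pgraph (ptotal T) = closure (pgraph t),
                bounded_adjointable T & compact_op (fun x => T x - x)].

Definition pseudo_left_inverse G t : Prop :=
  bounded_adjointable G /\ closable_to_one_mod_compact (pcomp (ptotal G) t).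

Definition pseudo_right_inverse G t : Prop :=
  bounded_adjointable G /\ closable_to_one_mod_compact (pcomp t (ptotal G)).

Definition fredholm_op t : Prop :=
  (exists G, pseudo_left_inverse G t) /\ (exists G, pseudo_right_inverse G t).

Definition selfadjoint_regular_fredholm t : Prop :=
  [/\ regular_op t, selfadjoint_op t & fredholm_op t].

Definition hip2 (z w : E * E) : A := hip z.1 w.1 + hip z.2 w.2.

(* The orthogonal projection when [M] is an orthogonally complemented
   submodule; the witness is then unique. *)
Definition orthoproj (M : set (E * E)) (z : E * E) : E * E :=
  xget 0 [set m | M m /\ forall n, M n -> hip2 n (z - m) = 0].

Definition gap t s : R :=
  ipopnorm hip2
    (fun z => orthoproj (pgraph t) z - orthoproj (pgraph s) z).

End Operators.

Definition continuous_path (R : realType) (T : Type) (d : T -> T -> R)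
    (J : interval R) (p : R -> T) : Prop :=
  forall l : R, l \in J ->
    d (p m) (p l) @[m --> within [set` J] (nbhs l)] --> (0 : R).

(* Main.v *)
Require Import Defs.
From HB Require Import structures.
From mathcomp Require Import all_boot all_order all_algebra.
From mathcomp Require Import complex.
From mathcomp Require Import all_classical all_reals all_analysis.
From mathcomp Require Import ring lra.

Set Implicit Arguments.
Unset Strict Implicit.
Unset Printing Implicit Defensive.

Import Order.TTheory GRing.Theory Num.Theory.
Import numFieldNormedType.Exports.

Local Open Scope classical_set_scope.
Local Open Scope complex_scope.
Local Open Scope ring_scope.

(** That the perturbed operators are selfadjoint, regular and Fredholm is the
    hypothesis on epsilon, so the content is the continuity of the gap.

    Let s and s' be selfadjoint regular operators with a common domain on which
    s' - s is bounded by delta, let z be a vector of the direct sum of two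
    copies of E, and let p and p' be its projections onto the two graphs.  As
    z - p and z - p' are orthogonal to the respective graphs, expanding
    p - p' = (z - p') - (z - p) gives
      <p - p', p - p'> = <p, z - p'> + <p', z - p>.
    Moving p = (x, s x) to the point (x, s' x) of the other graph, which is
    orthogonal to z - p', changes it by a vector of norm at most
    delta * |x| only; hence |p - p'|^2 = O(delta |z|^2) and the gap is
    O(sqrt delta) ([gap_le]).  The projections exist because 1 + s^2 maps onto E
    ([one_add_sq_surj]): its range is dense by regularity and closed because
    1 + s^2 is bounded below.

    These estimates compare the norm of the direct sum with the norms of its
    components: |<x, x>| <= |<x, x> + <y, y>|.  For inner products with values
    in a C*-algebra A this rests on the theorem of Fukamiya and Kaplansky that
    the elements a^* a form a convex cone on which the norm is monotone
    ([rnorm_starM_mono]).  It is proved without spectral theory, inside the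
    unital algebra of multipliers of A (the adjointable operators on A).
    Square roots are limits of an explicit iteration ([sqrt_one_sub]).  They
    show that h = h^* is a square of a selfadjoint element exactly when
    |M - h| <= M for some M >= 0, a condition that is stable under sums.  To see
    that h = w^* w is such a square, take k = |h| and q = k - h: then
    (w q)^* (w q) is minus a square, which forces w q = 0
    ([starM_neg_square]) and then q = 0.

    Constants do not matter for continuity, so the Cauchy-Schwarz inequality is
    used with the factor 4 that polarization gives ([rnorm_hip_le]). *)

(** * Real-valued norms and completeness *)

Section RealNorm.
Variables (R : realType) (V : normedModType R[i]).
Implicit Types (x y : V).

(** The norms of complex normed modules are elements of R[i]; their real part is
    the norm as a real number, to which ordered field tactics apply. *)
Definition rnorm x : R := complex.Re `|x|.

Lemma norm_rnorm x : `|x| = (rnorm x)%:C.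
Proof. by rewrite /rnorm RRe_real // normr_real. Qed.

Lemma rnorm_ge0 x : 0 <= rnorm x.
Proof. by rewrite -lecR -norm_rnorm normr_ge0. Qed.

Lemma rnorm0 : rnorm 0 = 0.
Proof. by rewrite /rnorm normr0. Qed.

Lemma rnorm_eq0 x : rnorm x <= 0 -> x = 0.
Proof.
move=> x0; apply/normr0_eq0; rewrite norm_rnorm.
by have -> : rnorm x = 0 by apply/le_anti; rewrite x0 rnorm_ge0.
Qed.

Lemma rnormD x y : rnorm (x + y) <= rnorm x + rnorm y.
Proof. by rewrite -lecR rmorphD /= -!norm_rnorm ler_normD. Qed.

Lemma rnormN x : rnorm (- x) = rnorm x.
Proof. by rewrite /rnorm normrN. Qed.

Lemma rnormB x y : rnorm (x - y) <= rnorm x + rnorm y.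
Proof. by rewrite (le_trans (rnormD _ _)) ?rnormN. Qed.

Lemma rnormZ (k : R[i]) x : rnorm (k *: x) = complex.Re `|k| * rnorm x.
Proof.
apply: complexI; rewrite -norm_rnorm normrZ norm_rnorm rmorphM /=.
by rewrite RRe_real // normr_real.
Qed.

Lemma rnormZr (r : R) x : rnorm (r%:C *: x) = `|r| * rnorm x.
Proof. by rewrite rnormZ normc_def /= expr0n addr0 sqrtr_sqr. Qed.

Lemma rnormZi x : rnorm ('i%C *: x) = rnorm x.
Proof. by rewrite rnormZ normc_def /= expr0n add0r expr1n sqrtr1 mul1r. Qed.

End RealNorm.

(** Rates of convergence [e] are only asked to become arbitrarily small, which is
    what passing to the limit in an estimate uses. *)
Lemma le0_of_le_rate (R : realType) (e : nat -> R) (C x : R) :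
  (forall d, 0 < d -> exists n, e n < d) -> 0 <= C ->
  (forall n, x <= C * e n) -> x <= 0.
Proof.
move=> e0 C0 xe; rewrite leNgt; apply/negP => x0.
have C10 : 0 < C + 1 by rewrite ltr_wpDl.
have [n en] := e0 (x / (C + 1)) (divr_gt0 x0 C10).
have := xe n; rewrite leNgt; apply/negP; rewrite negbK.
have [ln|/ltW pn] := leP (e n) 0; first by rewrite (le_lt_trans _ x0) ?mulr_ge0_le0.
move: en; rewrite ltr_pdivlMr // mulrC; apply: le_lt_trans.
by rewrite ler_wpM2r // lerDl.
Qed.

(** An explicit modulus replaces the Cauchy filter, so that the distance to the
    limit obeys the same bound. *)
Lemma complete_rate (R : realType) (V : completeNormedModType R[i])
    (u : nat -> V) (e : nat -> R) :
  (forall d, 0 < d -> exists n, e n < d) ->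
  (forall n m, (n <= m)%N -> rnorm (u m - u n) <= e n) ->
  exists2 l, u @ \oo --> l & forall n, rnorm (u n - l) <= e n.
Proof.
move=> e0 ue.
have : cauchy (u @ \oo).
  apply: cauchy_exP => d d0.
  have dR : d = (complex.Re d)%:C by rewrite RRe_real // gtr0_real.
  have d0' : 0 < complex.Re d by rewrite -ltcR -dR.
  have [n en] := e0 _ d0'.
  exists (u n); exists n => // m nm /=.
  rewrite -ball_normE /= distrC dR norm_rnorm ltcR.
  exact: le_lt_trans (ue _ _ nm) en.
move=> /cauchy_cvgP/cvg_ex[l /= ul]; exists l => // n.
apply/ler_addgt0Pr => d d0.
have dC0 : (0 : R[i]) < d%:C by rewrite ltcR.
have [N _ uN] := (cvgrPdist_lt _ _).1 ul _ dC0.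
set m := maxn n N.
have := uN m (leq_maxr _ _); rewrite /= norm_rnorm ltcR => lm.
have -> : u n - l = (u m - l) - (u m - u n) by rewrite opprB [RHS]addrC addrA subrK.
rewrite (le_trans (rnormB _ _)) // addrC lerD ?ue ?leq_maxl //.
by rewrite -rnormN opprB ltW.
Qed.

Section OperatorNorm.
Variables (R : realType) (V : normedModType R[i]).
Implicit Types (T : V -> V).

Definition opsup T : R := sup [set rnorm (T x) | x in [set x | rnorm x <= 1]].

Lemma opsup_le T (M : R) : 0 <= M ->
  (forall x, rnorm (T x) <= M * rnorm x) -> opsup T <= M.
Proof.
move=> M0 TM; apply: ge_sup.
  by exists (rnorm (T 0)), 0 => //=; rewrite rnorm0.
move=> _ [x /= x1 <-]; rewrite (le_trans (TM x)) //.
by rewrite -[leRHS]mulr1 ler_wpM2l.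
Qed.

Lemma opsup_ge0 T : 0 <= opsup T.
Proof.
rewrite /opsup; set S := [set _ | _ in _].
have [supS|/sup_out -> //] := pselect (has_sup S).
apply: (le_trans (rnorm_ge0 (T 0))); apply: sup_ubound; first by case: supS.
by exists 0 => //=; rewrite rnorm0.
Qed.

Lemma rnorm_le_opsup T x : (exists M, forall x, rnorm (T x) <= M * rnorm x) ->
  (forall (k : R[i]) x, T (k *: x) = k *: T x) ->
  rnorm (T x) <= opsup T * rnorm x.
Proof.
move=> [M TM] TZ.
have [x0|x0] := eqVneq (rnorm x) 0.
  by rewrite (le_trans (TM x)) // x0 !mulr0.
have xp : 0 < rnorm x by rewrite lt_neqAle eq_sym x0 rnorm_ge0.
have iE (z : V) : rnorm ((rnorm x)^-1%:C *: z) = (rnorm x)^-1 * rnorm z.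
  by rewrite rnormZr ger0_norm // invr_ge0 ltW.
rewrite -ler_pdivrMr // mulrC -iE -TZ.
apply: sup_ubound; last by exists ((rnorm x)^-1%:C *: x); rewrite //= iE mulVf.
exists (`|M|) => _ [z /= z1 <-]; rewrite (le_trans (TM z)) //.
rewrite (le_trans (ler_wpM2r (rnorm_ge0 z) (ler_norm M))) //.
by rewrite -[leRHS]mulr1 ler_wpM2l.
Qed.

End OperatorNorm.

(** * Elementary C*-algebra identities *)

Section CstarBasics.
Variables (R : realType) (A : cstarAlgebraType R).
Implicit Types (a b c : A).

Lemma cmul0a a : cmul 0 a = 0.
Proof. by apply: (addrI (cmul 0 a)); rewrite -cmulDl !addr0. Qed.

Lemma cmula0 a : cmul a 0 = 0.
Proof. by apply: (addrI (cmul a 0)); rewrite -cmulDr !addr0. Qed.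

Lemma cmulNa a b : cmul (- a) b = - cmul a b.
Proof. by apply: (addrI (cmul a b)); rewrite -cmulDl !subrr cmul0a. Qed.

Lemma cmulaN a b : cmul a (- b) = - cmul a b.
Proof. by apply: (addrI (cmul a b)); rewrite -cmulDr !subrr cmula0. Qed.

Lemma cmulBl a b c : cmul (a - b) c = cmul a c - cmul b c.
Proof. by rewrite cmulDl cmulNa. Qed.

Lemma cmulBr a b c : cmul a (b - c) = cmul a b - cmul a c.
Proof. by rewrite cmulDr cmulaN. Qed.

Lemma cstar0 : cstar (0 : A) = 0.
Proof. by apply: (addrI (cstar 0)); rewrite -cstarD !addr0. Qed.

Lemma cstarB a b : cstar (a - b) = cstar a - cstar b.
Proof. by apply: (addIr (cstar b)); rewrite -cstarD !subrK. Qed.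

Lemma rnormM a b : rnorm (cmul a b) <= rnorm a * rnorm b.
Proof. by rewrite -lecR rmorphM /= -!norm_rnorm cnormM. Qed.

Lemma rnorm_starM a : rnorm (cmul (cstar a) a) = rnorm a ^+ 2.
Proof. by apply: complexI; rewrite rmorphXn /= -!norm_rnorm cnorm_star. Qed.

Lemma rnorm_star a : rnorm (cstar a) = rnorm a.
Proof.
suff le b : rnorm b <= rnorm (cstar b).
  by apply/le_anti; rewrite le andbT -{2}(cstarK a) le.
have [->|b0] := eqVneq (rnorm b) 0; first exact: rnorm_ge0.
have bp : 0 < rnorm b by rewrite lt_neqAle eq_sym b0 rnorm_ge0.
by rewrite -(ler_pM2r bp) -expr2 -rnorm_starM rnormM.
Qed.

(** The product with all elements separates points, although A need not have
    a unit. *)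
Lemma cstar_cmul_inj a b :
  (forall c, cmul (cstar a) c = cmul (cstar b) c) -> a = b.
Proof.
move=> ab; apply/eqP; rewrite -subr_eq0; apply/eqP/rnorm_eq0.
by rewrite -[_ <= 0](@ler_pXn2r _ 2) ?nnegrE ?rnorm_ge0 // -rnorm_starM
  cstarB cmulBl ab subrr rnorm0 expr0n.
Qed.

Lemma cmul_inj a b : (forall c, cmul c a = cmul c b) -> a = b.
Proof.
move=> ab; apply: cstar_cmul_inj => c.
by rewrite -(cstarK c) -!cstarM ab.
Qed.

End CstarBasics.

(** * The multiplier algebra *)

Section Multipliers.
Variables (R : realType) (A : cstarAlgebraType R).

(** The adjointable operators on A, seen as a Hilbert module over itself with
    inner product a^* b.  Keeping the adjoint as a component gives the involution
    without a choice; linearity is a consequence of adjointability. *)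
Record multiplier := Multiplier {
  mfun : A -> A ;
  madj : A -> A ;
  madjP : forall x y, cmul (cstar (mfun x)) y = cmul (cstar x) (madj y) ;
  mfun_bounded : exists M, forall x, rnorm (mfun x) <= M * rnorm x }.

Implicit Types (f g h : multiplier) (x y : A).

Lemma multiplier_eq f g : mfun f =1 mfun g -> f = g.
Proof.
case: f g => [f f' fP fb] [g g' gP gb] /= fg.
have fgE : f = g by apply/funext.
have fgE' : f' = g'.
  by apply/funext => y; apply: cmul_inj => c; rewrite -(cstarK c) -fP -gP fgE.
by subst; congr Multiplier; exact: Prop_irrelevance.
Qed.

Lemma mfunD f x y : mfun f (x + y) = mfun f x + mfun f y.
Proof.
by apply: cstar_cmul_inj => z; rewrite cstarD cmulDl !madjP cstarD cmulDl.
Qed.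

Lemma mfunZ f (k : R[i]) x : mfun f (k *: x) = k *: mfun f x.
Proof.
by apply: cstar_cmul_inj => z; rewrite cstarZ cmulZl !madjP cstarZ cmulZl.
Qed.

Definition mnorm f : R := opsup (mfun f).

Lemma mnorm_ge0 f : 0 <= mnorm f. Proof. exact: opsup_ge0. Qed.

Lemma rnorm_mfun f x : rnorm (mfun f x) <= mnorm f * rnorm x.
Proof. by apply: rnorm_le_opsup; [exact: mfun_bounded | exact: mfunZ]. Qed.

Lemma mnorm_le f (M : R) : 0 <= M ->
  (forall x, rnorm (mfun f x) <= M * rnorm x) -> mnorm f <= M.
Proof. exact: opsup_le. Qed.

Fact madj_adj f x y : cmul (cstar (madj f x)) y = cmul (cstar x) (mfun f y).
Proof. by rewrite -[LHS]cstarK cstarM cstarK -madjP cstarM cstarK. Qed.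

(** From |f^* x|^2 = |(f^* x)^* f^* x| = |(f f^* x)^* x| one factor |f^* x| cancels. *)
Fact madj_norm f x : rnorm (madj f x) <= mnorm f * rnorm x.
Proof.
have [->|b0] := eqVneq (rnorm (madj f x)) 0.
  by rewrite mulr_ge0 ?mnorm_ge0 ?rnorm_ge0.
have bp : 0 < rnorm (madj f x) by rewrite lt_neqAle eq_sym b0 rnorm_ge0.
rewrite -(ler_pM2r bp) -expr2 -rnorm_starM madj_adj.
rewrite (le_trans (rnormM _ _)) // rnorm_star mulrAC mulrC.
by rewrite ler_wpM2r ?rnorm_ge0 // rnorm_mfun.
Qed.

Definition mstar f : multiplier :=
  Multiplier (madj_adj f) (ex_intro _ _ (madj_norm f)).

Fact zero_adj x y : cmul (cstar 0) y = cmul (cstar x) (0 : A).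
Proof. by rewrite cstar0 cmul0a cmula0. Qed.

Fact zero_bounded : exists M, forall x, rnorm (0 : A) <= M * rnorm x.
Proof. by exists 0 => x; rewrite rnorm0 mul0r. Qed.

Definition mzero : multiplier :=
  @Multiplier (fun=> 0) (fun=> 0) zero_adj zero_bounded.

Fact one_bounded : exists M, forall x, rnorm x <= M * rnorm x.
Proof. by exists 1 => x; rewrite mul1r. Qed.

Definition mone : multiplier :=
  @Multiplier id id (fun _ _ => erefl) one_bounded.

Fact add_adj f g x y : cmul (cstar (mfun f x + mfun g x)) y =
  cmul (cstar x) (madj f y + madj g y).
Proof. by rewrite cstarD cmulDl cmulDr !madjP. Qed.

Fact add_norm f g x :
  rnorm (mfun f x + mfun g x) <= (mnorm f + mnorm g) * rnorm x.
Proof. by rewrite (le_trans (rnormD _ _)) // mulrDl lerD ?rnorm_mfun. Qed.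

Definition madd f g : multiplier :=
  Multiplier (add_adj f g) (ex_intro _ _ (add_norm f g)).

Fact mul_adj f g x y : cmul (cstar (mfun f (mfun g x))) y =
  cmul (cstar x) (madj g (madj f y)).
Proof. by rewrite !madjP. Qed.

Fact mul_norm f g x :
  rnorm (mfun f (mfun g x)) <= (mnorm f * mnorm g) * rnorm x.
Proof.
rewrite (le_trans (rnorm_mfun _ _)) // -mulrA.
by rewrite ler_wpM2l ?mnorm_ge0 ?rnorm_mfun.
Qed.

Definition mmul f g : multiplier :=
  Multiplier (mul_adj f g) (ex_intro _ _ (mul_norm f g)).

Fact scale_adj (k : R[i]) f x y : cmul (cstar (k *: mfun f x)) y =
  cmul (cstar x) (conjc k *: madj f y).
Proof. by rewrite cstarZ cmulZl cmulZr madjP. Qed.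

Fact scale_norm (k : R[i]) f x :
  rnorm (k *: mfun f x) <= (complex.Re `|k| * mnorm f) * rnorm x.
Proof.
rewrite rnormZ -mulrA; apply: ler_wpM2l; last exact: rnorm_mfun.
by rewrite -lecR RRe_real ?normr_real ?normr_ge0.
Qed.

Definition mscale k f : multiplier :=
  Multiplier (scale_adj k f) (ex_intro _ _ (scale_norm k f)).

Definition mopp f := mscale (-1) f.

HB.instance Definition _ := gen_eqMixin multiplier.
HB.instance Definition _ := gen_choiceMixin multiplier.

Fact maddA : associative madd.
Proof. by move=> f g h; apply: multiplier_eq => x; rewrite /= addrA. Qed.

Fact maddC : commutative madd.
Proof. by move=> f g; apply: multiplier_eq => x; rewrite /= addrC. Qed.

Fact madd0 : left_id mzero madd.
Proof. by move=> f; apply: multiplier_eq => x; rewrite /= add0r. Qed.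

Fact maddN : left_inverse mzero mopp madd.
Proof. by move=> f; apply: multiplier_eq => x; rewrite /= scaleN1r addNr. Qed.

HB.instance Definition _ :=
  GRing.isZmodule.Build multiplier maddA maddC madd0 maddN.

Fact mmulA : associative mmul.
Proof. by move=> f g h; apply: multiplier_eq. Qed.

Fact mmul1 : left_id mone mmul.
Proof. by move=> f; apply: multiplier_eq. Qed.

Fact mmulr1 : right_id mone mmul.
Proof. by move=> f; apply: multiplier_eq. Qed.

Fact mmulDl : left_distributive mmul madd.
Proof. by move=> f g h; apply: multiplier_eq. Qed.

Fact mmulDr : right_distributive mmul madd.
Proof. by move=> f g h; apply: multiplier_eq => x; rewrite /= mfunD. Qed.

(** The ring is trivial when A = 0, hence the structure of possibly zero rings. *)
HB.instance Definition _ :=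
  GRing.Zmodule_isPzRing.Build multiplier mmulA mmul1 mmulr1 mmulDl mmulDr.

Fact mscaleA k l f : mscale k (mscale l f) = mscale (k * l) f.
Proof. by apply: multiplier_eq => x; rewrite /= scalerA. Qed.

Fact mscale1 : left_id 1 mscale.
Proof. by move=> f; apply: multiplier_eq => x; rewrite /= scale1r. Qed.

Fact mscaleDr : right_distributive mscale +%R.
Proof. by move=> k f g; apply: multiplier_eq => x; rewrite /= scalerDr. Qed.

Fact mscaleDl f : {morph mscale^~ f : k l / k + l}.
Proof. by move=> k l; apply: multiplier_eq => x; rewrite /= scalerDl. Qed.

HB.instance Definition _ := GRing.Zmodule_isLmodule.Build R[i] multiplier
  mscaleA mscale1 mscaleDr mscaleDl.

Lemma mscaleAl (k : R[i]) f g : (k *: f) * g = k *: (f * g).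
Proof. exact: multiplier_eq. Qed.

Lemma mscaleAr (k : R[i]) f g : f * (k *: g) = k *: (f * g).
Proof. by apply: multiplier_eq => x; rewrite /= mfunZ. Qed.

Lemma mstarK : involutive mstar.
Proof. by move=> f; apply: multiplier_eq. Qed.

Lemma mstarD f g : mstar (f + g) = mstar f + mstar g.
Proof. exact: multiplier_eq. Qed.

Lemma mstarM f g : mstar (f * g) = mstar g * mstar f.
Proof. exact: multiplier_eq. Qed.

Lemma mstarZ (k : R[i]) f : mstar (k *: f) = conjc k *: mstar f.
Proof. exact: multiplier_eq. Qed.

Lemma mstar1 : mstar 1 = 1.
Proof. exact: multiplier_eq. Qed.

Lemma mstarN f : mstar (- f) = - mstar f.
Proof. by rewrite -[- f]scaleN1r mstarZ rmorphN1 scaleN1r. Qed.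

Lemma mnormD f g : mnorm (f + g) <= mnorm f + mnorm g.
Proof.
by apply: mnorm_le; [rewrite addr_ge0 ?mnorm_ge0 | exact: add_norm].
Qed.

Lemma mnormM f g : mnorm (f * g) <= mnorm f * mnorm g.
Proof.
by apply: mnorm_le; [rewrite mulr_ge0 ?mnorm_ge0 | exact: mul_norm].
Qed.

Lemma mnorm0 : mnorm 0 = 0.
Proof.
apply/le_anti; rewrite mnorm_ge0 andbT; apply: mnorm_le => // x.
by rewrite /= rnorm0 mul0r.
Qed.

Lemma mnorm_eq0 f : mnorm f <= 0 -> f = 0.
Proof.
move=> f0; apply: multiplier_eq => x; apply: rnorm_eq0.
rewrite (le_trans (rnorm_mfun _ _)) // mulrC.
by rewrite mulr_ge0_le0 // rnorm_ge0.
Qed.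

Lemma mnorm1_le : mnorm 1 <= 1.
Proof. by apply: mnorm_le => // x; rewrite mul1r. Qed.

Lemma mnormZr (r : R) f : mnorm (r%:C *: f) = `|r| * mnorm f.
Proof.
have le s g : mnorm (s%:C *: g) <= `|s| * mnorm g.
  apply: mnorm_le => [|x]; first by rewrite mulr_ge0 ?mnorm_ge0.
  by rewrite /= rnormZr -mulrA ler_wpM2l ?rnorm_mfun.
apply/le_anti; rewrite le /=.
have [->|r0] := eqVneq r 0; first by rewrite normr0 mul0r mnorm_ge0.
rewrite -ler_pdivlMl ?normr_gt0 // -normfV.
by apply: le_trans (le _ _); rewrite scalerA -rmorphM mulVf // scale1r.
Qed.

Lemma mnormN f : mnorm (- f) = mnorm f.
Proof.
have -> : - f = (-1)%:C *: f by rewrite rmorphN1 scaleN1r.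
by rewrite mnormZr normrN1 mul1r.
Qed.

Lemma mnorm_star f : mnorm (mstar f) = mnorm f.
Proof.
have le g : mnorm (mstar g) <= mnorm g.
  by apply: mnorm_le => [|x]; rewrite ?mnorm_ge0 ?madj_norm.
by apply/le_anti; rewrite le -{1}(mstarK f) le.
Qed.

(** The C*-identity: |f x|^2 = |x^* (f^* f x)| <= |f^* f| |x|^2. *)
Lemma mnorm_starM f : mnorm (mstar f * f) = mnorm f ^+ 2.
Proof.
apply/le_anti; apply/andP; split.
  by rewrite (le_trans (mnormM _ _)) // mnorm_star expr2.
rewrite -[leRHS]sqr_sqrtr ?mnorm_ge0 // ler_pXn2r ?nnegrE ?mnorm_ge0 ?sqrtr_ge0//.
apply: mnorm_le; first exact: sqrtr_ge0.
move=> x; rewrite -[leLHS]ger0_norm ?rnorm_ge0 // -sqrtr_sqr.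
rewrite -[X in _ * X]ger0_norm ?rnorm_ge0 // -sqrtr_sqr -sqrtrM ?mnorm_ge0 //.
rewrite ler_wsqrtr // -rnorm_starM madjP (le_trans (rnormM _ _)) // rnorm_star.
rewrite mulrC expr2 mulrA ler_wpM2r ?rnorm_ge0 //.
exact: (rnorm_mfun (mstar f * f)).
Qed.

(** Both the values and the adjoints converge pointwise, and the adjunction
    passes to the limit. *)
Lemma multiplier_complete (u : nat -> multiplier) (e : nat -> R) :
  (forall d, 0 < d -> exists n, e n < d) ->
  (forall n m, (n <= m)%N -> mnorm (u m - u n) <= e n) ->
  exists l, forall n, mnorm (u n - l) <= e n.
Proof.
move=> e0 ue.
have e_ge0 n : 0 <= e n by apply: le_trans (ue n n (leqnn n)); exact: mnorm_ge0.
have lim (v : nat -> multiplier) :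
    (forall n m, (n <= m)%N -> mnorm (v m - v n) <= e n) ->
    {l : A -> A | forall n x, rnorm (mfun (v n) x - l x) <= rnorm x * e n}.
  move=> ve.
  have limx x : {lx | forall n, rnorm (mfun (v n) x - lx) <= rnorm x * e n}.
    apply/cid; suff [lx _ ulx] : exists2 lx, mfun (v n) x @[n --> \oo] --> lx &
        forall n, rnorm (mfun (v n) x - lx) <= rnorm x * e n by exists lx.
    apply: complete_rate => [d d0|n m nm].
      have x1 : 0 < rnorm x + 1 by rewrite ltr_wpDl ?rnorm_ge0.
      have [n en] := e0 _ (divr_gt0 d0 x1); exists n.
      move: en; rewrite ltr_pdivlMr // mulrC; apply: le_lt_trans.
      by rewrite ler_wpM2r // lerDl.
    rewrite -scaleN1r mulrC.
    apply: le_trans (rnorm_mfun (v m - v n) x) _.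
    by rewrite ler_wpM2r ?rnorm_ge0 ?ve.
  by exists (fun x => sval (limx x)) => n x; case: (limx x).
have [l ul] := lim u ue.
have [l' ul'] : {l' | forall n x,
    rnorm (madj (u n) x - l' x) <= rnorm x * e n}.
  apply: (lim (mstar \o u)) => n m nm /=.
  by rewrite -mstarN -mstarD mnorm_star ue.
have lP x y : cmul (cstar (l x)) y = cmul (cstar x) (l' y).
  apply/eqP; rewrite -subr_eq0; apply/eqP/rnorm_eq0.
  apply: (le0_of_le_rate (e := e) (C := 2 * (rnorm x * rnorm y))) => //.
    by rewrite !mulr_ge0 ?rnorm_ge0.
  move=> n.
  have -> : cmul (cstar (l x)) y - cmul (cstar x) (l' y) =
      cmul (cstar x) (madj (u n) y - l' y) -
      cmul (cstar (mfun (u n) x - l x)) y.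
    by rewrite cstarB cmulBl cmulBr madjP [RHS]addrC addrA opprB subrK.
  rewrite (le_trans (rnormB _ _)) // -mulrA mulr2n mulrDl mul1r.
  rewrite lerD // (le_trans (rnormM _ _)) // rnorm_star.
    by rewrite -mulrA ler_wpM2l ?rnorm_ge0.
  by rewrite mulrAC ler_wpM2r ?rnorm_ge0.
have lb : exists M, forall x, rnorm (l x) <= M * rnorm x.
  exists (mnorm (u 0%N) + e 0%N) => x.
  have -> : l x = mfun (u 0%N) x - (mfun (u 0%N) x - l x).
    by rewrite opprB addrC subrK.
  by rewrite (le_trans (rnormB _ _)) // mulrDl lerD ?rnorm_mfun // mulrC.
exists (Multiplier lP lb) => n; apply: mnorm_le => // x.
by rewrite /= scaleN1r mulrC.
Qed.

Fact lmul_bounded (a : A) : exists M, forall x, rnorm (cmul a x) <= M * rnorm x.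
Proof. by exists (rnorm a) => x; exact: rnormM. Qed.

Fact lmul_adj (a x y : A) :
  cmul (cstar (cmul a x)) y = cmul (cstar x) (cmul (cstar a) y).
Proof. by rewrite cstarM cmulA. Qed.

(** The embedding of A into its multipliers by left multiplication. *)
Definition lmul (a : A) : multiplier :=
  Multiplier (lmul_adj a) (lmul_bounded a).

Lemma lmulM a b : lmul (cmul a b) = lmul a * lmul b.
Proof. by apply: multiplier_eq => x; rewrite /= cmulA. Qed.

Lemma lmulD a b : lmul (a + b) = lmul a + lmul b.
Proof. by apply: multiplier_eq => x; rewrite /= cmulDl. Qed.

Lemma lmul_star a : lmul (cstar a) = mstar (lmul a).
Proof. exact: multiplier_eq. Qed.

(** Evaluation at a^* shows that the embedding is isometric. *)
Lemma mnorm_lmul a : mnorm (lmul a) = rnorm a.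
Proof.
apply/le_anti/andP; split.
  by apply: mnorm_le => [|x]; [exact: rnorm_ge0 | exact: rnormM].
have [->|a0] := eqVneq (rnorm a) 0; first exact: mnorm_ge0.
have ap : 0 < rnorm a by rewrite lt_neqAle eq_sym a0 rnorm_ge0.
rewrite -(ler_pM2r ap) -expr2 -rnorm_star -rnorm_starM cstarK.
exact: (rnorm_mfun (lmul a)).
Qed.

End Multipliers.

(** * Squares in the multiplier algebra *)

Lemma sqrrD_subB (S : pzRingType) (x y : S) :
  (x + y) * (x + y) - (x - y) * (x - y) = (x * y + y * x) + (x * y + y * x).
Proof.
have sqD (z : S) : (x + z) * (x + z) = (x * x + z * z) + (x * z + z * x).
  by rewrite mulrDl !mulrDr [z * x + _]addrC addrACA.
by rewrite !sqD mulrNN mulrN mulNr -opprD opprB addrC addrA subrK.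
Qed.

Section Squares.
Variables (R : realType) (A : cstarAlgebraType R).
Local Notation B := (multiplier A).
Implicit Types (a b c d h k w : B).

Local Notation sa h := (mstar h = h).
Local Notation rs r := (r%:C *: (1 : B)).

Lemma mnorm_sq h : sa h -> mnorm (h * h) = mnorm h ^+ 2.
Proof. by move=> hs; rewrite -{1}hs mnorm_starM. Qed.

Lemma mnormB a b : mnorm (a - b) <= mnorm a + mnorm b.
Proof. by rewrite (le_trans (mnormD _ _)) // mnormN. Qed.

Lemma mstarB a b : mstar (a - b) = mstar a - mstar b.
Proof. by rewrite mstarD mstarN. Qed.

Lemma mstar_rs (r : R) : sa (rs r).
Proof. by rewrite mstarZ mstar1 conjc_real. Qed.

Lemma rs_mulC (r : R) a : rs r * a = a * rs r.
Proof. by rewrite mscaleAl mscaleAr mul1r mulr1. Qed.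

Lemma mnorm_rs (r : R) : 0 <= r -> mnorm (rs r) <= r.
Proof.
by move=> r0; rewrite mnormZr ger0_norm // -[leRHS]mulr1 ler_wpM2l ?mnorm1_le.
Qed.

Lemma halfD a : 2^-1%:C *: a + 2^-1%:C *: a = a.
Proof.
rewrite -scalerDl -rmorphD /=.
have -> : 2^-1 + 2^-1 = 1 :> R by lra.
by rewrite scale1r.
Qed.

(** The defect 1 - sigma_n of the scalar iteration sigma' = (1 + sigma^2) / 2 that
    starts at 0 and increases to 1; it dominates the iteration in the algebra. *)
Fixpoint sqrt_err n : R :=
  if n is n'.+1 then sqrt_err n' - sqrt_err n' ^+ 2 / 2 else 1.

Lemma sqrt_err_itv n : 0 <= sqrt_err n <= 1.
Proof. by elim: n => [|n /andP[e0 e1]] /=; [lra | apply/andP; split; nra]. Qed.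

(** A lower bound d for all defects would make each step decrease by d^2 / 2. *)
Lemma sqrt_err_cvg (d : R) : 0 < d -> exists n, sqrt_err n < d.
Proof.
move=> d0; apply: contrapT => /forallNP dn.
have de n : d <= sqrt_err n by rewrite leNgt; apply/negP; exact: dn.
have dec n : sqrt_err n <= 1 - n%:R * (d ^+ 2 / 2).
  elim: n => [|n IH]; first by rewrite mul0r subr0.
  rewrite [sqrt_err _]/= -[n.+1%:R]natr1 mulrDl mul1r opprD addrA lerB //.
  by rewrite ler_wpM2r ?invr_ge0 // ler_pXn2r ?nnegrE ?de ?ltW // (lt_le_trans d0).
have d20 : 0 < d ^+ 2 / 2 by rewrite divr_gt0 ?exprn_gt0.
have [n dn'] : exists n : nat, (d ^+ 2 / 2)^-1 < n%:R.
  by exists (Num.bound (d ^+ 2 / 2)^-1); rewrite archi_boundP // invr_ge0 ltW.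
have := dec n; have := de n.
move: dn'; rewrite -[_^-1]mul1r ltr_pdivrMr //; lra.
Qed.

(** Writing the root of 1 - b as 1 - l turns (1 - l)^2 = 1 - b into the fixed
    point equation l = (b + l^2) / 2, solved by iteration from 0. *)
Fixpoint sqrt_step b n : B :=
  if n is n'.+1 then 2^-1%:C *: (b + sqrt_step b n' * sqrt_step b n') else 0.

Section SquareRoot.
Variable b : B.
Hypotheses (b_sa : sa b) (b_le1 : mnorm b <= 1).
Local Notation s := (sqrt_step b).
Local Notation e := sqrt_err.

Lemma sqrt_step_sa n : sa (s n).
Proof.
elim: n => [|n IH]; first exact: multiplier_eq.
by rewrite /= mstarZ conjc_real mstarD mstarM IH b_sa.
Qed.

Lemma sqrt_step_comm c n : b * c = c * b -> s n * c = c * s n.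
Proof.
move=> bc; elim: n => [|n IH] /=; first by rewrite mul0r mulr0.
by rewrite mscaleAl mscaleAr mulrDl mulrDr bc -mulrA IH !mulrA IH.
Qed.

Lemma sqrt_step_comm_step n m : s n * s m = s m * s n.
Proof. by apply: sqrt_step_comm; rewrite sqrt_step_comm. Qed.

Lemma mnorm_sqrt_step n : mnorm (s n) <= 1 - e n.
Proof.
elim: n => [|n IH] /=; first by rewrite mnorm0 subrr.
have /andP[e0 e1] := sqrt_err_itv n.
have n2 : mnorm (s n) ^+ 2 <= (1 - e n) ^+ 2.
  by rewrite ler_pXn2r ?nnegrE ?mnorm_ge0 ?subr_ge0.
rewrite mnormZr ger0_norm ?invr_ge0 //.
have := mnormD b (s n * s n); rewrite (mnorm_sq (sqrt_step_sa n)).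
by move: b_le1 n2; lra.
Qed.

(** The iterates commute, so a difference of squares factors and its norm is
    bounded by that of the scalar iteration. *)
Lemma sqrt_step_cauchy n m : (n <= m)%N -> mnorm (s m - s n) <= e n - e m.
Proof.
elim: n m => [|n IH] m; first by rewrite subr0 => _; exact: mnorm_sqrt_step.
case: m => // m /IH {}IH /=.
rewrite -scalerBr opprD addrACA subrr add0r.
have -> : s m * s m - s n * s n = (s m + s n) * (s m - s n).
  by rewrite mulrDl !mulrBr (sqrt_step_comm_step m n) addrA subrK.
rewrite mnormZr ger0_norm ?invr_ge0 //.
have := mnormM (s m + s n) (s m - s n); have := mnormD (s m) (s n).
have := mnorm_sqrt_step m; have := mnorm_sqrt_step n.
have := mnorm_ge0 (s m + s n); have := mnorm_ge0 (s m - s n); nra.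
Qed.

(** The bound |1 - k| <= 1 lets the construction be applied again to k; a
    fourth root is needed for [is_square_starM]. *)
Lemma sqrt_one_sub : exists k, [/\ sa k, k * k = 1 - b, mnorm (1 - k) <= 1 &
  forall c, b * c = c * b -> k * c = c * k].
Proof.
have [l sl] : exists l, forall n, mnorm (s n - l) <= e n.
  apply: multiplier_complete sqrt_err_cvg _ => n m /sqrt_step_cauchy.
  by have /andP[e0 _] := sqrt_err_itv m; lra.
have vanish (x : B) (C : R) : 0 <= C -> (forall n, mnorm x <= C * e n) -> x = 0.
  by move=> C0 xC; apply/mnorm_eq0/(le0_of_le_rate sqrt_err_cvg C0 xC).
have l_sa : sa l.
  apply/eqP; rewrite -subr_eq0; apply/eqP.
  apply: (vanish _ 2) => // n.
  have -> : mstar l - l = (s n - l) - mstar (s n - l).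
    by rewrite mstarB sqrt_step_sa opprB [RHS]addrC addrA subrK.
  have := mnormB (s n - l) (mstar (s n - l)); rewrite mnorm_star.
  by have := sl n; lra.
have l1 : mnorm l <= 1.
  have -> : l = s 0%N - (s 0%N - l) by rewrite opprB addrC subrK.
  by have := mnormB (s 0%N) (s 0%N - l); have := sl 0%N; rewrite mnorm0 /=; lra.
have lE : l + l = b + l * l.
  apply/eqP; rewrite -subr_eq0; apply/eqP.
  apply: (vanish _ 4) => // n.
  have -> : l + l - (b + l * l) =
      s n * (s n - l) + (s n - l) * l - ((s n.+1 - l) + (s n.+1 - l)).
    have -> : s n * (s n - l) + (s n - l) * l = s n * s n - l * l.
      by rewrite mulrBr mulrBl addrA subrK.
    have -> : s n.+1 - l + (s n.+1 - l) = b + s n * s n - (l + l).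
      by rewrite addrACA /= halfD opprD.
    by rewrite opprB [RHS]addrC !opprD !addrA subrK.
  have /andP[e0 e1] := sqrt_err_itv n.
  have sn : mnorm (s n) <= 1 by have := mnorm_sqrt_step n; lra.
  have := mnormB (s n * (s n - l) + (s n - l) * l)
                 (s n.+1 - l + (s n.+1 - l)).
  have := mnormD (s n * (s n - l)) ((s n - l) * l).
  have := mnormD (s n.+1 - l) (s n.+1 - l).
  have := mnormM (s n) (s n - l); have := mnormM (s n - l) l.
  have := sl n; have := sl n.+1; rewrite [e n.+1]/=.
  have := mnorm_ge0 (s n - l); have := mnorm_ge0 l; have := mnorm_ge0 (s n).
  nra.
exists (1 - l); split.
- by rewrite mstarB mstar1 l_sa.
- rewrite mulrBl mul1r mulrBr mulr1 opprB addrA addrAC -[1 - l - l]addrA -opprD lE.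
  by rewrite opprD addrA subrK.
- by rewrite opprB addrC subrK.
- move=> c bc; rewrite mulrBl mulrBr mul1r mulr1; congr (_ - _).
  apply/eqP; rewrite -subr_eq0; apply/eqP.
  apply: (vanish _ (2 * mnorm c)); first by rewrite mulr_ge0 ?mnorm_ge0.
  move=> n.
  have -> : l * c - c * l = c * (s n - l) - (s n - l) * c.
    by rewrite mulrBr mulrBl (sqrt_step_comm n bc) opprB [RHS]addrC addrA subrK.
  have := mnormB (c * (s n - l)) ((s n - l) * c).
  have := mnormM c (s n - l); have := mnormM (s n - l) c.
  by have := sl n; have := mnorm_ge0 c; nra.
Qed.

End SquareRoot.

(** Apply [sqrt_one_sub] to b = 1 - a / M and rescale. *)
Lemma sqrt_of_bound a (M : R) : sa a -> 0 <= M -> mnorm (rs M - a) <= M ->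
  exists k, [/\ sa k, k * k = a, mnorm (rs (Num.sqrt M) - k) <= Num.sqrt M &
    forall c, a * c = c * a -> k * c = c * k].
Proof.
move=> a_sa; rewrite le_eqVlt => /predU1P[<-|M0] aM.
  move: aM; rewrite scale0r sub0r mnormN => /mnorm_eq0 ->.
  exists 0; rewrite sqrtr0 scale0r subrr mnorm0 mulr0.
  by split=> //; exact: multiplier_eq.
pose b := 1 - M^-1%:C *: a.
have b1 : mnorm b <= 1.
  have -> : b = M^-1%:C *: (rs M - a).
    by rewrite scalerBr scalerA -rmorphM mulVf ?gt_eqF // scale1r.
  by rewrite mnormZr gtr0_norm ?invr_gt0 // ler_pdivrMl // mulr1.
have b_sa : sa b by rewrite mstarB mstar1 mstarZ conjc_real a_sa.
have [k [k_sa kk k1 kc]] := sqrt_one_sub b_sa b1.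
have sM := sqr_sqrtr (ltW M0); have s0 := sqrtr_ge0 M.
exists ((Num.sqrt M)%:C *: k); split.
- by rewrite mstarZ conjc_real k_sa.
- rewrite mscaleAl mscaleAr scalerA -rmorphM -expr2 sM kk opprB addrC subrK.
  by rewrite scalerA -rmorphM mulfV ?gt_eqF // scale1r.
- by rewrite -scalerBr mnormZr ger0_norm // -[leRHS]mulr1 ler_wpM2l.
- move=> c ac; rewrite mscaleAl mscaleAr kc // mulrBl mulrBr mul1r mulr1.
  by rewrite mscaleAl mscaleAr ac.
Qed.

(** For u = h + i k one has u^* u = M, so |u|^2 <= M, and 2 h = u + u^*. *)
Lemma mnorm_sq_pair h k (M : R) : sa h -> sa k -> h * k = k * h ->
  h * h + k * k = rs M -> 0 <= M -> mnorm h ^+ 2 <= M.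
Proof.
move=> hs ks hk hkM M0; pose u := h + 'i%C *: k.
have us : mstar u = h - 'i%C *: k.
  rewrite mstarD mstarZ hs ks -scaleNr; congr (_ + _ *: _).
  by rewrite /conjc /=; congr Complex; rewrite oppr0.
have uu : mstar u * u = rs M.
  rewrite us mulrBl !mulrDr !mscaleAl !mscaleAr !scalerA -hk.
  rewrite -[('i * 'i)%C]expr2 sqr_i scaleN1r.
  by rewrite opprD opprK addrA addrK hkM.
have uM : mnorm u ^+ 2 <= M by rewrite -mnorm_starM uu mnorm_rs.
have hu : 2 * mnorm h <= 2 * mnorm u.
  have -> : 2 * mnorm h = mnorm (u + mstar u).
    rewrite us addrACA subrr addr0.
    have -> : h + h = 2%:C *: h by rewrite rmorph_nat scaler_nat mulr2n.
    by rewrite mnormZr ger0_norm.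
  by have := mnormD u (mstar u); rewrite mnorm_star; lra.
by apply: le_trans uM; rewrite ler_pXn2r ?nnegrE ?mnorm_ge0 // -(ler_pM2l (ltr0n _ 2)).
Qed.

(** The element M - h^2 has a root k that commutes with h; now [mnorm_sq_pair]
    bounds k instead of h. *)
Lemma mnorm_sub_sq h (M : R) : sa h -> mnorm h ^+ 2 <= M ->
  mnorm (rs M - h * h) <= M.
Proof.
move=> hs hM; have M0 : 0 <= M by apply: le_trans hM; exact: sqr_ge0.
have [] := @sqrt_of_bound (rs M - h * h) M.
- by rewrite mstarB mstar_rs mstarM hs.
- by [].
- by rewrite opprB addrC subrK mnorm_sq.
move=> k [ks kk _ kc]; rewrite -kk (mnorm_sq ks).
apply: (mnorm_sq_pair (k := h)) => //; last by rewrite kk subrK.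
by apply: kc; rewrite mulrBl mulrBr rs_mulC mulrA.
Qed.

(** Squares of selfadjoint elements, which are the positive elements. *)
Definition is_square a := exists2 h, sa h & a = h * h.

Lemma is_square_sa a : is_square a -> sa a.
Proof. by move=> [h hs ->]; rewrite mstarM hs. Qed.

Lemma mnorm_sub_square a (M : R) :
  is_square a -> mnorm a <= M -> mnorm (rs M - a) <= M.
Proof.
by move=> [h hs ->] aM; apply: mnorm_sub_sq; rewrite // -mnorm_sq.
Qed.

Lemma is_square_bound a (M : R) :
  sa a -> 0 <= M -> mnorm (rs M - a) <= M -> is_square a.
Proof. by move=> aS M0 /(sqrt_of_bound aS M0)[k [ks <- _ _]]; exists k. Qed.

(** The condition |M - a| <= M, which characterizes squares, adds up. *)
Lemma is_squareD a b : is_square a -> is_square b -> is_square (a + b).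
Proof.
move=> aP bP; apply: (@is_square_bound _ (mnorm a + mnorm b)).
- by rewrite mstarD !is_square_sa.
- by rewrite addr_ge0 ?mnorm_ge0.
- rewrite rmorphD /= scalerDl opprD addrACA (le_trans (mnormD _ _)) //.
  by rewrite lerD ?mnorm_sub_square.
Qed.

Lemma is_squareZ a (r : R) : 0 <= r -> is_square a -> is_square (r%:C *: a).
Proof.
move=> r0 [h hs ->]; exists ((Num.sqrt r)%:C *: h).
  by rewrite mstarZ conjc_real hs.
by rewrite mscaleAl mscaleAr scalerA -rmorphM -[Num.sqrt r * _]expr2 sqr_sqrtr.
Qed.

Lemma is_square_rsB a (M : R) : sa a -> mnorm a <= M -> is_square (rs M - a).
Proof.
move=> aS aM; apply: (@is_square_bound _ M).
- by rewrite mstarB mstar_rs aS.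
- exact: le_trans (mnorm_ge0 _) aM.
- by rewrite opprB addrC subrK.
Qed.

(** The elements a and M - a are squares of commuting selfadjoint elements,
    because the root of M - a commutes with all that commutes with a. *)
Lemma mnorm_le_of_square a (M : R) : 0 <= M ->
  is_square a -> is_square (rs M - a) -> mnorm a <= M.
Proof.
move=> M0 [h hs ->] MaP.
have [] := sqrt_of_bound (is_square_sa MaP) (mnorm_ge0 _)
  (mnorm_sub_square MaP (lexx _)).
move=> k [ks kk _ kc]; rewrite mnorm_sq //.
apply: (mnorm_sq_pair (k := k)) => //; last by rewrite kk addrC subrK.
by apply/esym/kc; rewrite mulrBl mulrBr rs_mulC mulrA.
Qed.

Lemma mnorm_square_mono a b :
  is_square a -> is_square b -> mnorm a <= mnorm (a + b).
Proof.
move=> aP bP; apply: mnorm_le_of_square; rewrite ?mnorm_ge0 //.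
set M := mnorm _.
have -> : rs M - a = (rs M - (a + b)) + b by rewrite opprD addrA subrK.
apply: is_squareD => //; apply: is_square_rsB => //.
exact/is_square_sa/is_squareD.
Qed.

(** The hypothesis makes (s - r) - d a square.  In a nonzero algebra the lemma
    expresses that |r + d| = r + |d| for r >= 0. *)
Lemma mnorm_square_shift d (r s : R) : is_square d -> r <= s ->
  mnorm (rs r + d) <= s -> mnorm d <= s - r.
Proof.
move=> dP rs_ ds; apply: mnorm_le_of_square; rewrite ?subr_ge0 //.
have -> : rs (s - r) - d = rs s - (rs r + d).
  by rewrite rmorphB /= scalerBl opprD addrA.
by apply: is_square_rsB => //; rewrite mstarD mstar_rs is_square_sa.
Qed.

(** Let d = w w^* and T = |w|^2 = |d|.  Since d + w^* w is a sum of two squares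
    up to a factor, d is a square.  As w^* w is minus a square,
    T d + d^2 = w (T + w^* w) w^* has norm at most T^2, so
    |d + T/2|^2 <= 5/4 T^2 <= (9/8 T)^2.  But |d + T/2| = |d| + T/2 for a
    square d, so T = 0. *)
Lemma starM_neg_square w (g : B) : sa g -> mstar w * w = - (g * g) -> w = 0.
Proof.
move=> gs wg; pose d := w * mstar w.
have [T TE] : exists T, T = mnorm w ^+ 2 by exists (mnorm w ^+ 2).
have T0 : 0 <= T by rewrite TE sqr_ge0.
have dT : mnorm d = T by rewrite TE /d -{1}(mstarK w) mnorm_starM mnorm_star.
have gT : mnorm g ^+ 2 = T by rewrite TE -mnorm_sq // -mnormN -wg mnorm_starM.
have dP : is_square d.
  (* The real and, up to sign, imaginary parts of 2 w, so that
     2 (w w^* + w^* w) = u^2 + v^2. *)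
  pose u := w + mstar w; pose v := 'i%C *: (w - mstar w).
  have us : sa u by rewrite mstarD mstarK addrC.
  have vs : sa v.
    rewrite mstarZ mstarB mstarK -[X in _ = 'i%C *: X]opprB scalerN -scaleNr.
    by congr (_ *: _); rewrite /conjc /=; congr Complex; rewrite oppr0.
  have dE : d + d = (u * u + v * v) + (g * g + g * g).
    have -> : u * u + v * v = (d + mstar w * w) + (d + mstar w * w).
      have -> : v * v = - ((w - mstar w) * (w - mstar w)).
        by rewrite mscaleAl mscaleAr scalerA -[('i * 'i)%C]expr2 sqr_i scaleN1r.
      exact: sqrrD_subB.
    by rewrite wg addrACA !subrK.
  have -> : d = 2^-1%:C *: (d + d).
    by rewrite scalerDr halfD.
  rewrite dE; apply: is_squareZ; first by rewrite invr_ge0.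
  by apply: is_squareD; apply: is_squareD; [exists u|exists v|exists g|exists g].
have Td : rs T * d + d * d = w * (rs T - g * g) * mstar w.
  by rewrite -wg mulrDr mulrDl -rs_mulC !mulrA.
have TdT : mnorm (rs T * d + d * d) <= T ^+ 2.
  rewrite Td; have := mnormM (w * (rs T - g * g)) (mstar w).
  have := mnormM w (rs T - g * g); have := mnorm_ge0 w; rewrite mnorm_star.
  have : mnorm (rs T - g * g) <= T by apply: mnorm_sub_sq; rewrite ?gT.
  have := mnorm_ge0 (rs T - g * g).
  move: T0 TE; nra.
pose x := rs (T / 2) + d.
have xs : sa x by rewrite mstarD mstar_rs is_square_sa.
have xx : x * x = (rs T * d + d * d) + rs (T ^+ 2 / 4).
  have -> : T ^+ 2 / 4 = T / 2 * (T / 2) by field.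
  have rsE : rs T = rs (T / 2) + rs (T / 2).
    by rewrite -scalerDl -rmorphD /= -splitr.
  have rr : rs (T / 2) * rs (T / 2) = rs (T / 2 * (T / 2)).
    by rewrite mscaleAl mul1r scalerA -rmorphM.
  by rewrite /x rsE mulrDl !mulrDr -(rs_mulC _ d) rr mulrDl [RHS]addrC -!addrA.
have x_le : mnorm x <= 9 / 8 * T.
  rewrite -(@ler_pXn2r _ 2) ?nnegrE ?mnorm_ge0 //; last by lra.
  rewrite -mnorm_sq // xx (le_trans (mnormD _ _)) //.
  have : mnorm (rs (T ^+ 2 / 4)) <= T ^+ 2 / 4.
    by apply: mnorm_rs; rewrite divr_ge0 ?sqr_ge0.
  by move: TdT; have := sqr_ge0 T; lra.
have : mnorm d <= 9 / 8 * T - T / 2 by apply: mnorm_square_shift => //; lra.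
rewrite dT => TT; apply: mnorm_eq0.
have : T <= 0 by lra.
by rewrite TE -[leRHS](expr0n _ 2) ler_pXn2r ?nnegrE ?mnorm_ge0.
Qed.

(** The root k of h^2 plays the role of |h|; it is itself a square m^2. *)
Lemma square_root_abs h : sa h ->
  exists k m, [/\ sa k, sa m, k = m * m, k * k = h * h & m * h = h * m].
Proof.
move=> hs.
have hhs : sa (h * h) by rewrite mstarM hs.
have [k [ks kk k1 kc]] :=
  sqrt_of_bound hhs (sqr_ge0 _) (mnorm_sub_sq hs (lexx _)).
have [m [ms mm _ mc]] := sqrt_of_bound ks (sqrtr_ge0 _) k1.
exists k, m; split => //.
by apply/mc/kc; rewrite mulrA.
Qed.

(** With k = |h| = m^2 and q = k - h, the commuting h and k give h q = - k q, hence
    (w q)^* (w q) = q h q = - (m q)^2, and w q = 0 by [starM_neg_square].  Then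
    q k q = 0, so q^3 = 2 q k q = 0, q = 0 and h = k = m^2. *)
Lemma is_square_starM w : is_square (mstar w * w).
Proof.
set h := mstar w * w.
have hs : sa h by rewrite mstarM mstarK.
have [k [m [ks ms km kk mh]]] := square_root_abs hs.
have kh : k * h = h * k by rewrite km -mulrA mh mulrA mh -mulrA.
pose q := k - h; have qs : sa q by rewrite mstarB ks hs.
have hq : h * q = - (k * q) by rewrite !mulrBr kk kh opprB.
have qq : q * q = k * q + k * q.
  by rewrite {1}/q mulrBl hq opprK.
have mq : m * q = q * m.
  by rewrite mulrBr mulrBl mh km mulrA.
have wq : w * q = 0.
  apply: (@starM_neg_square _ (m * q)); first by rewrite mstarM qs ms mq.
  rewrite mstarM qs mulrA -[q * _ * w]mulrA -/h -mulrA hq mulrN {1}mq km.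
  by rewrite !mulrA.
have qkq : q * (k * q) = 0.
  by rewrite -[k * q]opprK -hq mulrN /h -!mulrA wq !mulr0 oppr0.
have qqq : q * (q * q) = 0 by rewrite qq mulrDr qkq addr0.
have sq0 (x : B) : sa x -> x * x = 0 -> x = 0.
  move=> xs xx; apply: mnorm_eq0.
  have /esym/eqP := mnorm_sq xs.
  by rewrite xx mnorm0 sqrf_eq0 => /eqP->.
have /sq0 q0 : q * q = 0.
  apply: sq0; first by rewrite mstarM qs.
  by rewrite -mulrA qqq mulr0.
by exists m => //; rewrite -km; apply/esym/eqP; rewrite -subr_eq0 -/q q0.
Qed.

(** The embedding in the multiplier algebra is isometric, so [mnorm_square_mono]
    comes down to A. *)
Lemma rnorm_starM_mono (x y : A) :
  rnorm (cmul (cstar x) x) <= rnorm (cmul (cstar x) x + cmul (cstar y) y).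
Proof.
rewrite -!mnorm_lmul lmulD !lmulM !lmul_star.
by apply: mnorm_square_mono; exact: is_square_starM.
Qed.

End Squares.

(** * Cauchy-Schwarz up to a constant *)

Section HilbertModuleBasics.
Variables (R : realType) (A : cstarAlgebraType R) (E : hilbertModuleType A).
Implicit Types (x y z : E).

Lemma hipx0 x : hip x (0 : E) = 0.
Proof. by apply: (addrI (hip x 0)); rewrite -hipDr !addr0. Qed.

Lemma hip0x x : hip (0 : E) x = 0.
Proof. by rewrite hip_star hipx0 cstar0. Qed.

Lemma hipNr x y : hip x (- y) = - hip x y.
Proof. by apply: (addrI (hip x y)); rewrite -hipDr !subrr hipx0. Qed.

Lemma hipBr x y z : hip x (y - z) = hip x y - hip x z.
Proof. by rewrite hipDr hipNr. Qed.

Lemma hipDl x y z : hip (x + y) z = hip x z + hip y z.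
Proof. by rewrite hip_star hipDr cstarD -!hip_star. Qed.

Lemma hipBl x y z : hip (x - y) z = hip x z - hip y z.
Proof. by rewrite hip_star hipBr cstarB -!hip_star. Qed.

Lemma hipZl (k : R[i]) x y : hip (k *: x) y = conjc k *: hip x y.
Proof. by rewrite hip_star hipZr cstarZ -hip_star. Qed.

Lemma hip_inj x y : (forall z, hip x z = hip y z) -> x = y.
Proof.
by move=> xy; apply/subr0_eq/(@hip_eq0 _ _ E); rewrite hipBl xy subrr.
Qed.

Lemma rnorm_hip x : rnorm (hip x x) = rnorm x ^+ 2.
Proof. by apply: complexI; rewrite rmorphXn /= -!norm_rnorm hnorm_ip. Qed.

Lemma ipnorm_hip x : ipnorm (@hip R A E) x = rnorm x.
Proof. by rewrite /ipnorm -/(rnorm _) rnorm_hip sqrtr_sqr ger0_norm ?rnorm_ge0. Qed.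

Lemma hip_polarization x y : hip x y *+ 4 =
  (hip (x + y) (x + y) - hip (x - y) (x - y)) +
  'i%C *: (hip ('i%C *: x + y) ('i%C *: x + y) -
           hip ('i%C *: x - y) ('i%C *: x - y)) :> A.
Proof.
have sub (u v : E) : hip (u + v) (u + v) - hip (u - v) (u - v) =
    (hip u v + hip v u) + (hip u v + hip v u) :> A.
  rewrite hipDl hipBl !hipDr !hipNr !opprB.
  rewrite [hip v u - _ + _]addrC addrACA [hip u u + _ + _]addrC.
  rewrite [hip u v - _ + _]addrA subrK [hip v u + _ + _]addrACA subrr addr0.
  by rewrite addrACA.
rewrite !sub hipZl hipZr.
have -> : conjc 'i = - 'i :> R[i] by rewrite /conjc; congr Complex; rewrite oppr0.
rewrite !scalerDr !scalerA mulrN -expr2 sqr_i opprK scale1r scaleN1r.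
by rewrite addrACA [X in X + X]addrACA subrr addr0 -!mulr2n -mulrnA.
Qed.

(** Polarization bounds |<x, y>| by (|x| + |y|)^2; apply this to x / |x| and y / |y|. *)
Lemma rnorm_hip_le x y : rnorm (hip x y) <= 4 * (rnorm x * rnorm y).
Proof.
have diag (u v : E) : rnorm (hip u v) <= (rnorm u + rnorm v) ^+ 2.
  suff : rnorm (hip u v *+ 4 : A) <= 4 * (rnorm u + rnorm v) ^+ 2.
    rewrite -scaler_nat -[4%:R](rmorph_nat (real_complex R)) rnormZr normr_nat.
    by rewrite ler_pM2l.
  rewrite hip_polarization (le_trans (rnormD _ _)) // rnormZi.
  have sq (w : E) : rnorm w <= rnorm u + rnorm v ->
      rnorm (hip w w) <= (rnorm u + rnorm v) ^+ 2.
    move=> wuv; rewrite rnorm_hip ler_pXn2r ?nnegrE ?rnorm_ge0 //.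
    by rewrite addr_ge0 ?rnorm_ge0.
  have := rnormB (hip (u + v) (u + v)) (hip (u - v) (u - v)).
  have := rnormB (hip ('i%C *: u + v) ('i%C *: u + v))
                 (hip ('i%C *: u - v) ('i%C *: u - v)).
  have := sq _ (rnormD u v); have := sq _ (rnormB u v).
  have := rnormD ('i%C *: u) v; have := rnormB ('i%C *: u) v; rewrite rnormZi.
  move=> /sq s1 /sq s2; lra.
have [x0|x0] := eqVneq (rnorm x) 0.
  have -> : x = 0 by apply: rnorm_eq0; rewrite x0.
  by rewrite hip0x !rnorm0 mul0r mulr0.
have [y0|y0] := eqVneq (rnorm y) 0.
  have -> : y = 0 by apply: rnorm_eq0; rewrite y0.
  by rewrite hipx0 !rnorm0 !mulr0.
have xp : 0 < rnorm x by rewrite lt_neqAle eq_sym x0 rnorm_ge0.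
have yp : 0 < rnorm y by rewrite lt_neqAle eq_sym y0 rnorm_ge0.
have := diag ((rnorm x)^-1%:C *: x) ((rnorm y)^-1%:C *: y).
rewrite !rnormZr !gtr0_norm ?invr_gt0 // !mulVf // hipZl hipZr conjc_real.
rewrite !rnormZr !gtr0_norm ?invr_gt0 // => h.
rewrite -ler_pdivrMr ?mulr_gt0 // invfM.
by rewrite mulrC -mulrA (le_trans h) //; lra.
Qed.

Lemma rnorm_hip_mono x y : rnorm (hip x x) <= rnorm (hip x x + hip y y).
Proof.
have [a ->] := hip_ge0 x; have [b ->] := hip_ge0 y.
exact: rnorm_starM_mono.
Qed.

End HilbertModuleBasics.

(** * The direct sum of two copies of a Hilbert module *)

Section DirectSum.
Variables (R : realType) (A : cstarAlgebraType R) (E : hilbertModuleType A).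
Implicit Types (z w : E * E).

Definition norm2 z : R := ipnorm (@hip2 R A E) z.

Lemma norm2_sq z : norm2 z ^+ 2 = rnorm (hip2 z z).
Proof. by rewrite sqr_sqrtr // rnorm_ge0. Qed.

Lemma norm2_ge0 z : 0 <= norm2 z.
Proof. exact: sqrtr_ge0. Qed.

Lemma rnorm_fst_le z : rnorm z.1 <= norm2 z.
Proof.
rewrite -(@ler_pXn2r _ 2) ?nnegrE ?rnorm_ge0 ?norm2_ge0 // norm2_sq.
by rewrite -rnorm_hip rnorm_hip_mono.
Qed.

Lemma rnorm_snd_le z : rnorm z.2 <= norm2 z.
Proof.
rewrite -(@ler_pXn2r _ 2) ?nnegrE ?rnorm_ge0 ?norm2_ge0 // norm2_sq.
by rewrite -rnorm_hip /hip2 addrC rnorm_hip_mono.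
Qed.

Lemma rnorm_hip2_le z w : rnorm (hip2 z w) <= 8 * (norm2 z * norm2 w).
Proof.
rewrite (le_trans (rnormD _ _)) //.
have := rnorm_hip_le z.1 w.1; have := rnorm_hip_le z.2 w.2.
have le1 : rnorm z.1 * rnorm w.1 <= norm2 z * norm2 w.
  by rewrite ler_pM ?rnorm_ge0 ?rnorm_fst_le.
have le2 : rnorm z.2 * rnorm w.2 <= norm2 z * norm2 w.
  by rewrite ler_pM ?rnorm_ge0 ?rnorm_snd_le.
lra.
Qed.

Lemma hip2Br z w w' : hip2 z (w - w') = hip2 z w - hip2 z w'.
Proof. by rewrite /hip2 !hipBr opprD addrACA. Qed.

Lemma hip2Bl z z' w : hip2 (z - z') w = hip2 z w - hip2 z' w.
Proof. by rewrite /hip2 !hipBl opprD addrACA. Qed.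

(** Orthogonality gives <p, p> = <p, z> and <z - p, z - p> = <z, z - p>; one
    factor cancels after Cauchy-Schwarz. *)
Lemma norm2_orth_le z p : hip2 p (z - p) = 0 ->
  norm2 p <= 8 * norm2 z /\ norm2 (z - p) <= 8 * norm2 z.
Proof.
move=> pz.
have cancel (a c : R) : 0 <= a -> 0 <= c -> a ^+ 2 <= 8 * (a * c) -> a <= 8 * c.
  rewrite le_eqVlt => /predU1P[<- c0 _|a0 _]; first by rewrite mulr_ge0.
  by rewrite mulrCA expr2 ler_pM2l.
split; apply: cancel; rewrite ?norm2_ge0 // norm2_sq.
  move/eqP: pz; rewrite hip2Br subr_eq0 => /eqP <-.
  exact: rnorm_hip2_le.
rewrite {1}hip2Bl pz subr0 [norm2 _ * _]mulrC.
exact: rnorm_hip2_le.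
Qed.

End DirectSum.

(** * The projection onto a selfadjoint graph *)

Lemma closed_pair (T U : topologicalType) (G : set (T * U))
    (u : nat -> T) (v : nat -> U) l l' :
  closed G -> (forall n, G (u n, v n)) ->
  u @ \oo --> l -> v @ \oo --> l' -> G (l, l').
Proof.
move=> Gc Guv ul vl.
apply: (@closed_cvg _ _ \oo _ (fun n => (u n, v n)) G Gc _ (l, l')).
  exact: nearW.
exact: cvg_pair.
Qed.

Section SelfadjointGraph.
Variables (R : realType) (A : cstarAlgebraType R) (E : hilbertModuleType A).
Variable s : partial_op E.
Hypotheses (s_reg : regular_op s) (s_sa : selfadjoint_op s).

Lemma padjoint_dom y : pdom (padjoint s) y <-> pdom s y.
Proof.
split=> [y_dom|y_dom].
  suff [] : pgraph s (y, pval (padjoint s) y) by [].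
  by rewrite s_sa.
suff [] : pgraph (padjoint s) (y, pval s y) by [].
by rewrite -s_sa.
Qed.

Lemma padjoint_val y : pdom s y -> pval (padjoint s) y = pval s y.
Proof.
move=> y_dom; suff [_ /= ->] : pgraph (padjoint s) (y, pval s y) by [].
by rewrite -s_sa.
Qed.

Lemma selfadjoint_sym x y : pdom s x -> pdom s y ->
  hip (pval s x) y = hip x (pval s y).
Proof.
move=> x_dom y_dom; rewrite -(padjoint_val y_dom).
have : pdom (padjoint s) y by apply/padjoint_dom.
by move=> /(xgetPex (0 : E)); apply.
Qed.

Lemma linear_opB x y : pdom s x -> pdom s y ->
  pdom s (x - y) /\ pval s (x - y) = pval s x - pval s y.
Proof.
have [[_ sD sZ _] _ _ _ _] := s_reg.
move=> xs ys; have [ys' ysE] := sZ (-1) _ ys.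
have [] := sD _ _ xs ys'; rewrite !scaleN1r in ysE *.
by rewrite ysE.
Qed.

(** Pairing (1 + s^2) x with x gives <x, x> + <s x, s x>, which dominates each
    of its terms. *)
Lemma one_add_sq_bound x : pdom s x -> pdom s (pval s x) ->
  rnorm x <= 4 * rnorm (x + pval s (pval s x)) /\
  rnorm (pval s x) <= 4 * rnorm (x + pval s (pval s x)).
Proof.
move=> xs sxs; set v := x + _.
have ipE : hip v x = hip x x + hip (pval s x) (pval s x).
  by rewrite hipDl (selfadjoint_sym sxs xs).
have vx := rnorm_hip_le v x.
have x_le : rnorm x ^+ 2 <= 4 * (rnorm v * rnorm x).
  by rewrite -rnorm_hip (le_trans _ vx) // ipE rnorm_hip_mono.
have sx_le : rnorm (pval s x) ^+ 2 <= 4 * (rnorm v * rnorm x).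
  by rewrite -rnorm_hip (le_trans _ vx) // ipE addrC rnorm_hip_mono.
have v0 := rnorm_ge0 v; have x0 := rnorm_ge0 x.
have xv : rnorm x <= 4 * rnorm v.
  have [->|xn0] := eqVneq (rnorm x) 0; first by rewrite mulr_ge0.
  have xp : 0 < rnorm x by rewrite lt_neqAle eq_sym xn0.
  by rewrite -(ler_pM2r xp) -mulrA -expr2.
split=> //; rewrite -(@ler_pXn2r _ 2) ?nnegrE ?rnorm_ge0 ?mulr_ge0 //.
by rewrite (le_trans sx_le) //; nra.
Qed.

(** If x_n + s^2 x_n converges, the lower bounds make x_n, s x_n and s^2 x_n
    converge, and closedness of s identifies the limits. *)
Lemma one_add_sq_surj v : exists x,
  [/\ pdom s x, pdom s (pval s x) & x + pval s (pval s x) = v].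
Proof.
have [_ s_closed _ _ u_dense] := s_reg.
pose e n : R := n.+1%:R^-1.
have e_gt0 n : 0 < e n by rewrite invr_gt0.
have e_dec n m : (n <= m)%N -> e m <= e n.
  by move=> nm; rewrite lef_pV2 ?posrE // ler_nat.
have e_cvg (C d : R) : 0 < C -> 0 < d -> exists n, C * e n < d.
  move=> C0 d0; exists (Num.bound (C / d)).
  rewrite ltr_pdivrMr // mulrC -ltr_pdivrMr //.
  have := archi_boundP (ltW (divr_gt0 C0 d0)).
  by move=> /lt_trans; apply; rewrite ltr_nat.
have approx n : exists x, [/\ pdom s x, pdom s (pval s x) &
    rnorm (x + pval s (pval s x) - v) <= e n].
  have eC : (0 : R[i]) < (e n)%:C by rewrite ltcR.
  have [||y0 [vy [x [_ [xs /padjoint_dom sxs]] y0E]]] := u_dense (ball v (e n)%:C).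
  - by exists v; exact: ballxx.
  - exact: ball_open.
  have {}y0E : x + pval (padjoint s) (pval s x) = y0 := y0E.
  exists x; split => //; move: vy; rewrite -y0E (padjoint_val sxs).
  by rewrite -ball_normE /= distrC norm_rnorm ltcR => /ltW.
have [x xP] := choice approx.
pose y n := pval s (x n); pose z n := pval s (y n).
have rate n m : (n <= m)%N -> [/\ rnorm (x m - x n) <= 8 * e n,
    rnorm (y m - y n) <= 8 * e n & rnorm (z m - z n) <= 10 * e n].
  move=> nm; have [xs ys xv] := xP n; have [xs' ys' xv'] := xP m.
  have [dxs dxE] := linear_opB xs' xs; have [dys dyE] := linear_opB ys' ys.
  have := one_add_sq_bound dxs; rewrite dxE => /(_ dys).
  rewrite dyE -/(y _) -/(y _) -/(z _) -/(z _).
  have wE : x m - x n + (z m - z n) = (x m + z m - v) - (x n + z n - v).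
    by rewrite opprB [RHS]addrA subrK opprD addrACA.
  have := rnormB (x m + z m - v) (x n + z n - v); rewrite -wE.
  have := rnormB (x m - x n + (z m - z n)) (x m - x n); rewrite addrAC subrr add0r.
  by have := e_dec _ _ nm; move: xv xv'; rewrite -/(z _) => ? ? ? ? ? [? ?]; split; lra.
have [X xX xX'] := complete_rate (e_cvg 8 ^~ (ltr0n _ _))
  (fun n m nm => let: And3 h _ _ := rate n m nm in h).
have [Y yY _] := complete_rate (e_cvg 8 ^~ (ltr0n _ _))
  (fun n m nm => let: And3 _ h _ := rate n m nm in h).
have [Z zZ zZ'] := complete_rate (e_cvg 10 ^~ (ltr0n _ _))
  (fun n m nm => let: And3 _ _ h := rate n m nm in h).
have [Xs YE] : pgraph s (X, Y).
  by apply: (closed_pair s_closed _ xX yY) => n; split; have [] := xP n.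
have [Ys ZE] : pgraph s (Y, Z).
  by apply: (closed_pair s_closed _ yY zZ) => n; split; have [] := xP n.
move: Xs YE Ys ZE => /= Xs YE Ys ZE.
exists X; rewrite -YE; split => //; rewrite -ZE.
apply/subr0_eq/rnorm_eq0.
(* 8 and 10 for the distances to X and Z, 1 for the approximation of v. *)
apply: (le0_of_le_rate (e_cvg 19 ^~ (ltr0n _ _)) ler01) => n.
have -> : X + Z - v = (x n + z n - v) - ((x n - X) + (z n - Z)).
  by rewrite [x n - X + _]addrACA -opprD opprB [RHS]addrC [RHS]addrA subrK.
have [_ _ xv] := xP n.
have := rnormB (x n + z n - v) ((x n - X) + (z n - Z)).
have := rnormD (x n - X) (z n - Z); have := xX' n; have := zZ' n.
by move: xv; rewrite -/(z _); lra.
Qed.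

(** Solve x1 + s^2 x1 = z.1 and x2 + s^2 x2 = z.2.  Then z is the sum of the point
    of the graph over x1 + s x2 and of (s q, - q) with q = s x1 - x2, and all
    (s q, - q) are orthogonal to the graph. *)
Lemma graph_projection_exists (z : E * E) :
  exists p, pgraph s p /\ forall n, pgraph s n -> hip2 n (z - p) = 0.
Proof.
have [[_ sD _ _] _ _ _ _] := s_reg.
have [x1 [x1s y1s e1]] := one_add_sq_surj z.1.
have [x2 [x2s y2s e2]] := one_add_sq_surj z.2.
have [ps pE] := sD _ _ x1s y2s.
have [qs qE] := linear_opB y1s x2s.
exists (x1 + pval s x2, pval s (x1 + pval s x2)); split=> // -[y _] [/= ys ->].
rewrite /hip2 /=.
have -> : z.1 - (x1 + pval s x2) = pval s (pval s x1 - x2).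
  by rewrite qE -e1 opprD addrACA subrr add0r.
have -> : z.2 - pval s (x1 + pval s x2) = - (pval s x1 - x2).
  by rewrite pE -e2 opprB opprD addrACA subrr addr0 addrC.
by rewrite hipNr (selfadjoint_sym ys qs) subrr.
Qed.

Lemma orthoproj_graph (z : E * E) : pgraph s (orthoproj (pgraph s) z) /\
  forall n, pgraph s n -> hip2 n (z - orthoproj (pgraph s) z) = 0.
Proof. exact: xgetPex (graph_projection_exists z). Qed.

End SelfadjointGraph.

(** * Estimate of the gap *)

Section Gap.
Variables (R : realType) (A : cstarAlgebraType R) (E : hilbertModuleType A).
Implicit Types (s t : partial_op E).

(** Only the second component of the projection onto the first graph has to be
    moved to reach the second graph. *)
Lemma orthoproj_cross s t (delta : R) (z : E * E) :
  regular_op s -> selfadjoint_op s -> regular_op t -> selfadjoint_op t ->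
  pdom s `<=` pdom t ->
  (forall x, pdom s x -> rnorm (pval t x - pval s x) <= delta * rnorm x) ->
  0 <= delta ->
  rnorm (hip2 (orthoproj (pgraph s) z) (z - orthoproj (pgraph t) z)) <=
    16 ^+ 2 * delta * norm2 z ^+ 2.
Proof.
move=> sr ss tr ts st_dom st delta0.
have [pG pO] := orthoproj_graph sr ss z; have [qG qO] := orthoproj_graph tr ts z.
have [p_le _] := norm2_orth_le (pO _ pG); have [_ q_le] := norm2_orth_le (qO _ qG).
move: pG p_le q_le; set p := orthoproj _ z; set w := z - _ => -[p_dom pE] p_le q_le.
pose p' := (p.1, pval t p.1).
have p'w : hip2 p' w = 0 by apply: qO; split=> //=; exact: st_dom.
have -> : hip2 p w = - hip (pval t p.1 - pval s p.1) w.2.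
  by rewrite -[LHS]subr0 -p'w /hip2 /= pE hipBl opprD addrACA subrr add0r opprB.
rewrite rnormN (le_trans (rnorm_hip_le _ _)) //.
have p1 := rnorm_fst_le p; have w2 := rnorm_snd_le w.
have Dp := st _ p_dom.
have h1 : rnorm (pval t p.1 - pval s p.1) <= delta * (8 * norm2 z).
  by rewrite (le_trans Dp) // ler_wpM2l // (le_trans p1).
have h2 : rnorm w.2 <= 8 * norm2 z := le_trans w2 q_le.
have := ler_pM (rnorm_ge0 _) (rnorm_ge0 _) h1 h2; lra.
Qed.

(** Writing p - q = (z - q) - (z - p) in the second argument of <p - q, p - q>
    leaves the two cross terms of [orthoproj_cross].  They bound the square of
    |p - q|, whence the square root of delta. *)
Lemma gap_le s t (delta : R) :
  regular_op s -> selfadjoint_op s -> regular_op t -> selfadjoint_op t ->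
  pdom s = pdom t ->
  (forall x, pdom s x -> rnorm (pval t x - pval s x) <= delta * rnorm x) ->
  0 <= delta ->
  gap s t <= Num.sqrt (2 * (16 ^+ 2 * delta)).
Proof.
move=> sr ss tr ts st_dom st delta0.
apply: ge_sup.
  exists (norm2 (orthoproj (pgraph s) 0 - orthoproj (pgraph t) 0 : E * E)).
  by exists 0 => //=; rewrite /ipnorm /hip2 /= !hip0x addr0 normr0 sqrtr0.
move=> _ [z /= z1 <-]; rewrite -/(norm2 _) in z1 *.
rewrite -[leLHS]ger0_norm ?norm2_ge0 // -sqrtr_sqr ler_wsqrtr // norm2_sq.
have [pG pO] := orthoproj_graph sr ss z; have [qG qO] := orthoproj_graph tr ts z.
have ps : rnorm (hip2 (orthoproj (pgraph s) z) (z - orthoproj (pgraph t) z)) <=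
    16 ^+ 2 * delta * norm2 z ^+ 2.
  by apply: orthoproj_cross => //; rewrite st_dom.
have qs : rnorm (hip2 (orthoproj (pgraph t) z) (z - orthoproj (pgraph s) z)) <=
    16 ^+ 2 * delta * norm2 z ^+ 2.
  apply: orthoproj_cross => //; first by rewrite st_dom.
  by move=> x; rewrite -st_dom => /st; rewrite -rnormN opprB.
set p := orthoproj _ z in pG pO ps qs *; set q := orthoproj _ z in qG qO ps qs *.
have -> : hip2 (p - q) (p - q) = hip2 p (z - q) + hip2 q (z - p).
  have {2}-> : p - q = (z - q) - (z - p) by rewrite opprB [RHS]addrC [RHS]addrA subrK.
  by rewrite hip2Br !hip2Bl (pO _ pG) (qO _ qG) subr0 sub0r opprK.
have z2 : norm2 z ^+ 2 <= 1 by rewrite expr_le1 ?norm2_ge0.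
have zd : 16 ^+ 2 * delta * norm2 z ^+ 2 <= 16 ^+ 2 * delta.
  by rewrite -[leRHS]mulr1 ler_wpM2l // mulr_ge0 // exprn_ge0.
rewrite (le_trans (rnormD _ _)) // mulrDl mul1r.
by rewrite lerD // (le_trans _ zd).
Qed.

(** A supremum of nonnegative numbers, or 0 by convention if unbounded. *)
Lemma gap_ge0 s t : 0 <= gap s t.
Proof.
rewrite /gap /ipopnorm; set S := [set _ | _ in _].
have [supS|/sup_out -> //] := pselect (has_sup S).
pose f (z : E * E) := orthoproj (pgraph s) z - orthoproj (pgraph t) z.
apply: (le_trans (norm2_ge0 (f 0))); apply: sup_ubound; first by case: supS.
by exists 0 => //=; rewrite /ipnorm /hip2 /= !hip0x addr0 normr0 sqrtr0.
Qed.

End Gap.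

(** * Perturbation by bounded operators *)

Section BoundedPerturbations.
Variables (R : realType) (A : cstarAlgebraType R) (E : hilbertModuleType A).

Lemma bounded_adjointableZ (T : E -> E) (k : R[i]) x :
  bounded_adjointable T -> T (k *: x) = k *: T x.
Proof.
by move=> [_ [S TS]]; apply: (@hip_inj _ _ E) => y; rewrite hipZl !TS hipZl.
Qed.

Lemma rnorm_le_opdist (T S : E -> E) x :
  bounded_adjointable T -> bounded_adjointable S ->
  rnorm (T x - S x) <= opdist T S * rnorm x.
Proof.
move=> Tb Sb.
have -> : opdist T S = opsup (fun x => T x - S x).
  rewrite /opdist /opnorm /ipopnorm /opsup.
  by have -> : ipnorm (@hip R A E) = @rnorm R E by apply/funext/ipnorm_hip.
apply: (rnorm_le_opsup (T := fun x => T x - S x)) => [|k y]; last first.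
  by rewrite (bounded_adjointableZ _ _ Tb) (bounded_adjointableZ _ _ Sb) scalerBr.
have [[[M TM] _] [[N SN] _]] := (Tb, Sb); exists (M + N) => y.
rewrite (le_trans (rnormB _ _)) // mulrDl -!ipnorm_hip.
by rewrite lerD.
Qed.

Lemma opdist_ge0 (T S : E -> E) : 0 <= opdist T S.
Proof.
rewrite /opdist /opnorm /ipopnorm.
have -> : ipnorm (@hip R A E) = @rnorm R E by apply/funext/ipnorm_hip.
exact: opsup_ge0.
Qed.

Lemma padd_ptotalC (t : partial_op E) (D : E -> E) :
  padd t (ptotal D) = padd (ptotal D) t.
Proof.
by congr PartialOp; [exact: setIC | apply/funext => x; rewrite addrC].
Qed.

End BoundedPerturbations.

Theorem theorem3p15 (R : realType) (A : cstarAlgebraType R)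
    (E : hilbertModuleType A) (t : partial_op E) (eps : R)
    (J : interval R) (a : R -> E -> E)
    (ht : selfadjoint_regular_fredholm t)
    (eps_gt0 : 0 < eps)
    (heps : forall D : E -> E, bounded_selfadjoint D -> opnorm D <= eps ->
       selfadjoint_regular_fredholm (padd (ptotal D) t))
    (ha : forall l : R, l \in J -> bounded_selfadjoint (a l))
    (ha_cont : continuous_path (@opdist R A E) J a)
    (ha_le : forall l : R, l \in J -> opnorm (a l) <= eps) :
  (forall l : R, l \in J ->
     selfadjoint_regular_fredholm (padd t (ptotal (a l)))) /\
  continuous_path (@gap R A E) J (fun l => padd t (ptotal (a l))).
Proof.
have srf l : l \in J -> selfadjoint_regular_fredholm (padd t (ptotal (a l))).
  by move=> lJ; rewrite padd_ptotalC; apply: heps; [exact: ha | exact: ha_le].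
split=> // l lJ.
apply: (@squeeze_cvgr _ _ _ _ (fun=> 0)
  (fun m => Num.sqrt (2 * (16 ^+ 2 * opdist (a m) (a l))))).
- near=> m.
  have mJ : m \in J by near: m; exact: withinT.
  rewrite gap_ge0 /=.
  have [mr ms _] := srf m mJ; have [lr ls _] := srf l lJ.
  apply: gap_le => //; last exact: opdist_ge0.
  move=> x _ /=; rewrite opprD addrACA subrr add0r -rnormN opprB.
  by apply: rnorm_le_opdist; [case: (ha m mJ) | case: (ha l lJ)].
- exact: cvg_cst.
- rewrite -[X in _ --> X]sqrtr0 -[X in Num.sqrt X](mulr0 2).
  rewrite -[X in 2 * X](mulr0 (16 ^+ 2)).
  apply: (continuous_cvg _ (@sqrt_continuous R _)).
  by do 2! apply: cvgZr; exact: ha_cont.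
Unshelve. all: end_near.
Qed.
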